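(* Let $I \subseteq \mathbb{R}$ be an interval, let $f,g$ be similarly ordered, nonnegative and $MT$-convex functions on $I$, let $a,b \in I$ with $a<b$, and suppose $fg \in L_1[a,b]$. Then $$\frac{1}{b-a}\int_a^b \mu(x) f(x) g(x)\,dx \leq \frac{f(a)g(a)+f(b)g(b)}{8},$$ where $\mu(x) = \frac{(b-x)(x-a)}{(b-a)^2}$ for $x \in [a,b]$.
   Context: A function $f: I \subseteq \mathbb{R} \to \mathbb{R}$ is said to be $MT$-convex on $I$ (to belong to the class $MT(I)$) if it is nonnegative and for all $x,y \in I$ and all $t \in (0,1)$ it satisfies $$f(tx+(1-t)y) \leq \frac{\sqrt{t}}{2\sqrt{1-t}} f(x) + \frac{\sqrt{1-t}}{2\sqrt{t}} f(y).$$ Two functions $f,g: X \to \mathbb{R}$ are similarly ordered (here with $X = I$) if $(f(x)-f(y))(g(x)-g(y)) \geq 0$ for every $x,y \in X$. $L_1[a,b]$ denotes the Lebesgue integrable functions on $[a,b]$. *)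

(* Defs.v *)
From HB Require Import structures.
From mathcomp Require Import all_boot all_order all_algebra.
From mathcomp Require Import all_classical all_reals all_analysis.

Set Implicit Arguments.
Unset Strict Implicit.
Unset Printing Implicit Defensive.

Import Order.TTheory GRing.Theory Num.Theory.
Import numFieldNormedType.Exports.

Local Open Scope classical_set_scope.
Local Open Scope ring_scope.

(* A function on a subset [I] of the reals is represented by a total function
   [f : R -> R], whose values outside [I] are never constrained. *)

Definition MT_convex (R : realType) (I : set R) (f : R -> R) : Prop :=
  (forall x, I x -> 0 <= f x) /\
  (forall x y t, I x -> I y -> 0 < t < 1 ->
     f (t * x + (1 - t) * y) <=
       Num.sqrt t / (2 * Num.sqrt (1 - t)) * f x +
       Num.sqrt (1 - t) / (2 * Num.sqrt t) * f y).

Definition similarly_ordered (R : realType) (X : set R) (f g : R -> R) : Prop :=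
  forall x y, X x -> X y -> 0 <= (f x - f y) * (g x - g y).

(* The library's [lebesgue_measure] lives on the Borel sigma-algebra; the
   completed measure is the one for which measurable means Lebesgue
   measurable. *)
Definition L1 (R : realType) (a b : R) (f : R -> R) : Prop :=
  (@completed_lebesgue_measure R).-integrable `[a, b] (fun x => (f x)%:E).

Definition mu_weight (R : realType) (a b x : R) : R :=
  (b - x) * (x - a) / (b - a) ^+ 2.

(* Main.v *)
(* For x = t a + (1 - t) b with 0 < t < 1, MT-convexity reads
   2 sqrt(t (1 - t)) f(x) <= t f(a) + (1 - t) f(b), and likewise for g, while
   mu(x) = t (1 - t). Multiplying the two bounds and applying Chebyshev's
   inequality to the similarly ordered values at a and b gives
   4 mu(x) f(x) g(x) <= t f(a) g(a) + (1 - t) f(b) g(b), whose right-hand side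
   is affine in x with mean (f(a) g(a) + f(b) g(b)) / 2 over [a, b]. *)

Require Import Defs.
From HB Require Import structures.
From mathcomp Require Import all_boot all_order all_algebra.
From mathcomp Require Import all_classical all_reals all_analysis.
From mathcomp Require Import measurable_realfun ring lra.

Set Implicit Arguments.
Unset Strict Implicit.
Unset Printing Implicit Defensive.

Import Order.TTheory GRing.Theory Num.Theory.
Import numFieldNormedType.Exports.

Local Open Scope classical_set_scope.
Local Open Scope ring_scope.

(* The carrier of [completed_lebesgue_measure]. *)
Notation lebesgue_type R :=
  (caratheodory_type ((wlength (idfun : R -> R))^*)%mu).

(** This makes [lebesgue_measure] available as the pushforward of the completed measure along the
    identity. *)
Lemma measurable_lebesgue_borel (R : realType) :
  measurable_fun [set: lebesgue_type R] 
    (idfun : lebesgue_type R -> measurableTypeR R).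
Proof.
by move=> _ A mA; rewrite setTI; exact: sub_caratheodory.
Qed.

Lemma measurable_fun_lebesgue (R : realType) (D : set (measurableTypeR R))
    (h : measurableTypeR R -> R) :
  measurable D -> measurable_fun D h ->
  measurable_fun (D : set (lebesgue_type R)) (h : lebesgue_type R -> R).
Proof.
move=> mD mh _ A mA.
by apply: sub_caratheodory; exact: mh.
Qed.

(** Change of variables along the identity: the pushforward of the completed measure agrees with
    [lebesgue_measure] on Borel sets. It carries Borel computations, such as the fundamental theorem
    of calculus, over to the completed measure. *)
Lemma ge0_completed_lebesgue_integral (R : realType)
    (D : set (measurableTypeR R)) (h : measurableTypeR R -> \bar R) :
  measurable D -> measurable_fun D h -> (forall x, D x -> (0 <= h x)%E) ->
  (\int[@completed_lebesgue_measure R]_(x in D) h x =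
   \int[lebesgue_measure]_(x in D) h x)%E.
Proof.
move=> mD mh h0.
have h0' : {in D, forall y, (0 <= h y)%E} by move=> y /[!inE]; exact: h0.
rewrite -(@ge0_integral_pushforward _ _ (lebesgue_type R) _ R _
  (@measurable_lebesgue_borel R) (@completed_lebesgue_measure R) D h mD mh h0').
apply: eq_measure_integral; first exact: measurable_lebesgue_borel.
by move=> mid A mA AD.
Qed.

Lemma integral_affine (R : realType) (a b p q : R) : a < b ->
  (\int[lebesgue_measure]_(x in `[a, b]) (p * (b - x) + q * (x - a))%:E =
   ((p + q) * (b - a) ^+ 2 / 2)%:E)%E.
Proof.
(* An antiderivative in which each square vanishes at one endpoint. *)
move=> ab; pose F x : R := (q * (x - a) ^+ 2 - p * (b - x) ^+ 2) / 2.
have dF (x : R) : is_derive x (1 : R) F (p * (b - x) + q * (x - a)).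
  rewrite /F; apply: is_derive_eq.
  by rewrite /GRing.scale /=; field.
have cF : continuous F.
  by move=> x; apply: differentiable_continuous;
    apply/derivable1_diffP; case: (dF x).
rewrite (@continuous_FTC2 _ _ F)//.
- rewrite -EFinB; congr EFin; by rewrite /F; field.
- apply: continuous_subspaceT => x.
  by apply: cvgD; apply: cvgMr; apply: cvgB => //; exact: cvg_cst.
- split; [by move=> x _; case: (dF x)| |].
  + exact/cvg_at_right_filter/cF.
  + exact/cvg_at_left_filter/cF.
- by move=> x _; rewrite derive1E; case: (dF x).
Qed.

(** Multiplying the defining inequality by [2 * Num.sqrt (t * (1 - t))] cancels both denominators
    and leaves the squares of the two roots as coefficients. *)
Lemma MT_convex_bound (R : realType) (I : set R) (f : R -> R) (x y t : R) :
  MT_convex I f -> I x -> I y -> 0 < t < 1 ->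
  2 * Num.sqrt (t * (1 - t)) * f (t * x + (1 - t) * y) <=
  t * f x + (1 - t) * f y.
Proof.
move=> [_ /(_ x y t)] + Ix Iy t01 => /(_ Ix Iy t01).
have /andP[t0 t1] := t01; have s0 : 0 < 1 - t by lra.
rewrite sqrtrM; last exact: ltW.
have := sqr_sqrtr (ltW t0); have := sqr_sqrtr (ltW s0).
have : 0 < Num.sqrt t by rewrite sqrtr_gt0.
have : 0 < Num.sqrt (1 - t) by rewrite sqrtr_gt0.
move: (Num.sqrt t) (Num.sqrt (1 - t)) => u v v0 u0 vE uE h.
apply: le_trans (ler_wpM2l _ h) _; first by rewrite !mulr_ge0 ?ltW.
rewrite -vE -uE le_eqVlt; apply/orP; left; apply/eqP.
by field; rewrite !gt_eqF.
Qed.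

Lemma MT_convex_mul_bound (R : realType) (I : set R) (f g : R -> R)
    (x y t : R) :
  MT_convex I f -> MT_convex I g -> similarly_ordered I f g ->
  I x -> I y -> 0 < t < 1 -> I (t * x + (1 - t) * y) ->
  4 * (t * (1 - t)) *
    (f (t * x + (1 - t) * y) * g (t * x + (1 - t) * y)) <=
  t * (f x * g x) + (1 - t) * (f y * g y).
Proof.
move=> cf cg so Ix Iy t01 Iz; have /andP[t0 t1] := t01.
have hf := MT_convex_bound cf Ix Iy t01.
have hg := MT_convex_bound cg Ix Iy t01.
have f0 := cf.1 _ Iz; have g0 := cg.1 _ Iz.
have tt0 : 0 <= t * (1 - t) by rewrite mulr_ge0//; lra.
have s0 := sqrtr_ge0 (t * (1 - t)); have sE := sqr_sqrtr tt0.
move: (Num.sqrt _) s0 sE hf hg => s s0 sE hf hg.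
(* Multiplying the two bounds requires nonnegative left-hand sides; this is where nonnegativity at
   the intermediate point enters. *)
have l0 (w : R) : 0 <= w -> 0 <= 2 * s * w by move=> w0; rewrite !mulr_ge0.
have := ler_pM (l0 _ f0) (l0 _ g0) hf hg.
have -> : forall u w : R, 2 * s * u * (2 * s * w) = 4 * (t * (1 - t)) * (u * w).
  by move=> u w; rewrite -sE; ring.
move=> /le_trans; apply.
(* Chebyshev: the gap is [t (1 - t) (f x - f y) (g x - g y)]. *)
rewrite -subr_ge0.
rewrite (_ : _ - _ = t * (1 - t) * ((f x - f y) * (g x - g y))); last by ring.
by rewrite mulr_ge0//; exact: so.
Qed.

Lemma mu_weight_mul_bound (R : realType) (I : set R) (f g : R -> R)
    (a b x : R) :
  is_interval I -> MT_convex I f -> MT_convex I g -> similarly_ordered I f g ->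
  I a -> I b -> a < b -> a <= x <= b ->
  mu_weight a b x * f x * g x <=
  f a * g a / (4 * (b - a)) * (b - x) + f b * g b / (4 * (b - a)) * (x - a).
Proof.
move=> hI cf cg so Ia Ib ab axb; have /andP[ax xb] := axb.
have ba0 : 0 < b - a by lra.
have Ix : I x by apply: hI axb.
have A0 : 0 <= f a * g a by rewrite mulr_ge0 ?cf.1 ?cg.1.
have B0 : 0 <= f b * g b by rewrite mulr_ge0 ?cf.1 ?cg.1.
(* At the endpoints [t] would be 0 or 1, outside the range of MT-convexity; there the weight
   vanishes and the right-hand side is nonnegative. *)
have [xab|xab] := boolP ((x == a) || (x == b)).
  have -> : mu_weight a b x = 0.
    rewrite /mu_weight; case/orP: xab => /eqP ->; rewrite subrr ?mulr0 mul0r//.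
    by rewrite mul0r.
  rewrite !mul0r; move: (f a * g a) (f b * g b) A0 B0 => A B A0 B0.
  by rewrite addr_ge0// mulr_ge0 ?divr_ge0//; lra.
move: xab; rewrite negb_or => /andP[xa xb'].
have {}ax : a < x by rewrite lt_neqAle eq_sym xa.
have {}xb : x < b by rewrite lt_neqAle xb'.
(* The barycentric coordinate of [x], for which [t * (1 - t)] is [mu_weight a b x]. *)
pose t := (b - x) / (b - a).
have t01 : 0 < t < 1.
  by rewrite /t divr_gt0 ?ltr_pdivrMr// ?mul1r; lra.
have xE : t * a + (1 - t) * b = x by rewrite /t; field; rewrite gt_eqF.
have := MT_convex_mul_bound cf cg so Ia Ib t01; rewrite xE => /(_ Ix).
have -> : 4 * (t * (1 - t)) * (f x * g x) = 4 * (mu_weight a b x * f x * g x).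
  by rewrite /t /mu_weight; field; rewrite gt_eqF.
rewrite (_ : t * _ + _ = 4 * (f a * g a / (4 * (b - a)) * (b - x) +
  f b * g b / (4 * (b - a)) * (x - a))).
  by rewrite ler_pM2l.
by rewrite /t; field; rewrite gt_eqF.
Qed.

(** Both [b - x] and [x - a] lie between 0 and [b - a]. The upper bound 1 lets [f x * g x] dominate
    the weighted integrand. *)
Lemma mu_weight_itv (R : realType) (a b x : R) :
  a < b -> a <= x <= b -> 0 <= mu_weight a b x <= 1.
Proof.
move=> ab /andP[ax xb]; rewrite /mu_weight.
have ba0 : 0 < (b - a) ^+ 2 by rewrite exprn_gt0 // subr_gt0.
apply/andP; split; first by rewrite divr_ge0 ?(ltW ba0)// mulr_ge0 ?subr_ge0.
by rewrite ler_pdivrMr//; nra.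
Qed.

Theorem theorem5 (R : realType) (I : set R) (f g : R -> R) (a b : R)
    (hI : is_interval I)
    (hso : similarly_ordered I f g)
    (hf0 : forall x, I x -> 0 <= f x)
    (hg0 : forall x, I x -> 0 <= g x)
    (hf : MT_convex I f)
    (hg : MT_convex I g)
    (ha : I a) (hb : I b) (hab : a < b)
    (hfg : L1 a b (fun x => f x * g x)) :
  (b - a)^-1 *
    \int[@completed_lebesgue_measure R]_(x in `[a, b])
      (mu_weight a b x * f x * g x)
  <= (f a * g a + f b * g b) / 8.
Proof.
have ba0 : 0 < b - a by rewrite subr_gt0.
have mab : measurable (`[a, b] : set (lebesgue_type R)).
  by apply: sub_caratheodory; exact: (@measurable_itv R).
set p := f a * g a / (4 * (b - a)); set q := f b * g b / (4 * (b - a)).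
have p0 : 0 <= p by rewrite divr_ge0 ?mulr_ge0 ?hf0 ?hg0// ltW.
have q0 : 0 <= q by rewrite divr_ge0 ?mulr_ge0 ?hf0 ?hg0// ltW.
pose h x : R := p * (b - x) + q * (x - a).
have h0 x : `[a, b]%classic x -> 0 <= h x.
  by rewrite /= in_itv/= => /andP[? ?]; rewrite addr_ge0// mulr_ge0// subr_ge0.
have mh : measurable_fun (`[a, b] : set R) h.
  by apply: measurable_funD; apply: measurable_funM => //;
    apply: measurable_funB.
have hint : (\int[@completed_lebesgue_measure R]_(x in `[a, b]) (h x)%:E =
    ((p + q) * (b - a) ^+ 2 / 2)%:E)%E.
  rewrite ge0_completed_lebesgue_integral ?integral_affine//.
  - exact/measurable_EFinP.
(* Monotonicity of the real-valued integral asks for integrability on both sides: [ih] for the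
   affine bound, [iw] for the weighted product. *)
have ih : (@completed_lebesgue_measure R).-integrable `[a, b] (EFin \o h).
  apply/integrableP; split.
    by apply/measurable_EFinP; apply: measurable_fun_lebesgue.
  under eq_integral => x /[!inE] xab do rewrite /= ger0_norm ?h0//.
  by rewrite hint ltry.
have iw : (@completed_lebesgue_measure R).-integrable `[a, b]
    (EFin \o (fun x => mu_weight a b x * f x * g x)).
  apply: (le_integrable _ _ _ hfg) => //.
    apply/measurable_EFinP.
    (* The product of [f] and [g] is kept as one factor because [hfg] gives measurability of the
       product, not of each function. *)
    rewrite (_ : (fun x => _) = mu_weight a b \* (fun x => f x * g x));
      last first.
      by apply/funext => x /=; rewrite mulrA.
    apply: measurable_funM; last exact/measurable_EFinP/(measurable_int _ hfg).
    apply: (@measurable_fun_lebesgue R) => //.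
    by apply: measurable_funM => //; apply: measurable_funM;
      apply: measurable_funB.
  move=> x /=; rewrite in_itv/= => axb.
  have /andP[m0 m1] := mu_weight_itv hab axb.
  by rewrite lee_fin -mulrA normrM ger0_norm// ler_piMl.
rewrite ler_pdivrMl//.
apply: (@le_trans _ _ (\int[@completed_lebesgue_measure R]_(x in `[a, b]) h x)).
  apply: le_Rintegral => // x; rewrite /= in_itv/= => axb.
  exact: (mu_weight_mul_bound hI hf hg hso ha hb hab axb).
(* The factor 8 is the 4 in [p] and [q] times the 2 from the mean of an affine function. *)
rewrite /Rintegral hint/= le_eqVlt; apply/orP; left; apply/eqP.
by rewrite /p /q; field; rewrite gt_eqF.
Qed.
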